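(* Let $R$ be a commutative ring with nonzero identity, $M$ an $R$-module, $\phi:S(M)\to S(M)\cup\{\emptyset\}$ a function and $N$ a proper submodule of $M$. The following conditions are equivalent. (1) $N$ is a $\phi$-classical 1-absorbing prime submodule of $M$. (2) For all nonunits $a,b,c\in R$, $(N:_M abc)=(\phi(N):_M abc)\cup(N:_M ab)\cup(N:_M c)$. (3) For all nonunits $a,b\in R$ and $m\in M$ with $abm\notin N$, $(N:_R abm)=(\phi(N):_R abm)\cup(N:_R m)$. (4) For all nonunits $a,b\in R$ and $m\in M$ with $abm\notin N$, $(N:_R abm)=(\phi(N):_R abm)$ or $(N:_R abm)=(N:_R m)$. (5) For all nonunits $a,b\in R$, every ideal $I$ of $R$ and $m\in M$ with $abIm\subseteq N$ and $abIm\nsubseteq\phi(N)$, either $abm\in N$ or $Im\subseteq N$. (6) For all nonunits $a,b\in R$, $m\in M$ and every proper ideal $I$ of $R$ with $abIm\subseteq N$ and $abIm\nsubseteq\phi(N)$, either $aIm\subseteq N$ or $bm\in N$. (7) For every proper ideal $I$ of $R$, nonunit $a\in R$ and $m\in M$ with $aIm\nsubseteq N$, $(N:_R aIm)=(\phi(N):_R aIm)$ or $(N:_R aIm)=(N:_R m)$. (8) For all proper ideals $I,J,K$ of $R$ and $m\in M$ with $IJKm\subseteq N$ and $IJKm\nsubseteq\phi(N)$, either $IJm\subseteq N$ or $Km\subseteq N$.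
   Context: All modules are unitary. $S(M)$ is the set of all submodules of $M$. Standing assumption: $\phi(N)\subseteq N$ for every submodule $N$. A proper submodule $N$ of $M$ is $\phi$-classical 1-absorbing prime if whenever $a,b,c\in R$ are nonunits and $m\in M$ with $abcm\in N\setminus\phi(N)$, then $abm\in N$ or $cm\in N$. Notation: $(A:_M a)=\{m\in M: am\in A\}$ for $a\in R$; $(A:_R X)=\{r\in R: rX\subseteq A\}$ for $X\subseteq M$ and $(A:_R m)=\{r\in R: rm\in A\}$ for $m\in M$; when $A=\emptyset$ these sets are empty (for nonempty $X$). *)

(* Defs.v *)
From HB Require Import structures.
From mathcomp Require Import all_boot all_order all_algebra.
From mathcomp Require Import boolp classical_sets.

Set Implicit Arguments.
Unset Strict Implicit.
Unset Printing Implicit Defensive.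

Import GRing.Theory.
Local Open Scope ring_scope.
Local Open Scope classical_set_scope.

(* [GRing.unit] is available only on [unitRingType], which carries a boolean
   test and an inverse function; none of this is needed here. *)
Definition nonunit (R : comNzRingType) (a : R) : Prop :=
  ~ exists b : R, a * b = 1.

Definition is_submodule (R : comNzRingType) (M : lmodType R) (A : set M) : Prop :=
  GRing.submod_closed [in A].

Record submodule (R : comNzRingType) (M : lmodType R) := Submodule {
  submodule_set :> set M;
  _ : is_submodule submodule_set
}.

(* S(M) together with the empty set, which is never a submodule: the codomain
   of phi. *)
Record submodule_or_empty (R : comNzRingType) (M : lmodType R) :=
  SubmoduleOrEmpty {
    submodule_or_empty_set :> set M;
    _ : is_submodule submodule_or_empty_set \/ submodule_or_empty_set = set0
  }.

(* R^o is R as a module over itself. *)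
Definition is_ideal (R : comNzRingType) (I : set R) : Prop :=
  @is_submodule R R^o I.

Definition is_proper_ideal (R : comNzRingType) (I : set R) : Prop :=
  is_ideal I /\ I <> [set: R].

Definition ideal_mul (R : comNzRingType) (I J : set R) : set R :=
  [set r | exists (n : nat) (x y : 'I_n -> R),
     [/\ forall k, I (x k), forall k, J (y k) & r = \sum_(k < n) x k * y k]].

(* (A :_M a) *)
Definition colonM (R : comNzRingType) (M : lmodType R) (A : set M) (a : R) :
  set M := [set m | A (a *: m)].

(* (A :_R X); for A = set0 this is empty as soon as X is nonempty. *)
Definition colonR (R : comNzRingType) (M : lmodType R) (A X : set M) :
  set R := [set r | [set r *: x | x in X] `<=` A].

(* (A :_R m) *)
Definition colon1 (R : comNzRingType) (M : lmodType R) (A : set M) (m : M) :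
  set R := [set r | A (r *: m)].

(* I m; for an ideal I this is already a submodule. *)
Definition set_scale (R : comNzRingType) (M : lmodType R) (I : set R) (m : M) :
  set M := [set i *: m | i in I].

(* a I; for an ideal I this is already an ideal. *)
Definition mul_set (R : comNzRingType) (a : R) (I : set R) : set R :=
  [set a * i | i in I].

Definition phi_classical_1abs_prime (R : comNzRingType) (M : lmodType R)
    (phi : submodule M -> submodule_or_empty M) (N : submodule M) : Prop :=
  (N : set M) <> [set: M] /\
  forall (a b c : R) (m : M), nonunit a -> nonunit b -> nonunit c ->
    ((N : set M) `\` phi N) ((a * b * c) *: m) ->
    (N : set M) ((a * b) *: m) \/ (N : set M) (c *: m).

(* Main.v *)
(* The conditions are proved in a cycle. Two facts about additive subgroups do
   the work. If a subgroup is the union of two subgroups, it is one of them,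
   which turns the unions of colons in (3) and in the proof of (7) into an
   alternative. If x0 in an ideal I escapes phi(N) or N after
   multiplication by the other factors and x in I does not, then x + x0
   escapes too, so a conclusion valid for all escaping elements holds for x0 and
   x + x0, hence for x. The passage from (8) back to (1) uses principal
   ideals. *)
Require Import Defs.
From HB Require Import structures.
From mathcomp Require Import all_boot all_order all_algebra.
From mathcomp Require Import boolp classical_sets.

Set Implicit Arguments.
Unset Strict Implicit.
Unset Printing Implicit Defensive.

Import GRing.Theory.
Local Open Scope ring_scope.
Local Open Scope classical_set_scope.

(** * Subsets closed under differences *)

(** Membership of 0 is left out on purpose: every value of [phi], the empty one included, then
    qualifies. *)
Definition sub_closed (G : zmodType) (B : set G) : Prop :=
  forall x y, B x -> B y -> B (x - y).

Lemma sub_closedD (G : zmodType) (B : set G) x y :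
  sub_closed B -> B x -> B y -> B (x + y).
Proof.
move=> hB Bx By; rewrite -[y]opprK; apply: (hB) => //.
(* 0 is not known to lie in [B] beforehand; it is obtained as [y - y]. *)
by rewrite -sub0r -(subrr y); do 2?[apply: (hB)].
Qed.

(* The sets may be empty, so this also covers colons of [phi N = set0]. *)
Lemma sub_closedU (G : zmodType) (A B C : set G) :
  sub_closed A -> sub_closed B -> sub_closed C ->
  C = A `|` B -> C = A \/ C = B.
Proof.
move=> hA hB hC CE.
have [AB|/existsNP[x /not_implyP[Ax nBx]]] := pselect (A `<=` B).
  by right; rewrite CE setUidr.
left; rewrite CE setUidl// => y By.
(* With [x] in [A] outside [B] and [y] in [B], the difference cannot fall in [B], since that would
   bring [x] into [B]; so it falls in [A] and brings [y] along. *)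
have : C (x - y) by apply: hC; rewrite CE; [left|right].
rewrite CE => -[Axy|Bxy]; first by rewrite -(subKr x y); exact: hA.
by exfalso; apply: nBx; rewrite -(subrK y x); exact: sub_closedD.
Qed.

(** * Submodules, ideals and products of ideals *)

Section Submodules.
Context {R : comNzRingType} {M : lmodType R}.
Implicit Types (A : set M) (I J : set R).

Lemma is_submodule0 A : is_submodule A -> A 0.
Proof. by case=> /set_mem. Qed.

Lemma is_submodule_lin A (r : R) (x y : M) :
  is_submodule A -> A x -> A y -> A (r *: x + y).
Proof.
by case=> _ hA Ax Ay; apply: set_mem; apply: hA; apply: mem_set.
Qed.

Lemma submoduleP (L : submodule M) : is_submodule L.
Proof. by case: L. Qed.

Lemma is_submoduleB A : is_submodule A -> sub_closed A.
Proof.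
by move=> hA x y Ax Ay; rewrite addrC -scaleN1r; exact: is_submodule_lin.
Qed.

Lemma is_submoduleZ A (r : R) (x : M) : is_submodule A -> A x -> A (r *: x).
Proof.
move=> hA Ax; rewrite -[_ *: _]addr0.
by apply: is_submodule_lin => //; exact: is_submodule0.
Qed.

(** An element rules out the alternative [set0]. *)
Lemma submodule_or_empty_submodule (P : submodule_or_empty M) (x : M) :
  (P : set M) x -> is_submodule P.
Proof. by case: P => P /= [//|->]. Qed.

Lemma submodule_or_emptyB (P : submodule_or_empty M) : sub_closed P.
Proof.
move=> x y Px; have /is_submoduleB hP := submodule_or_empty_submodule Px.
exact: hP.
Qed.

Lemma colon1_sub_closed A (m : M) : sub_closed A -> sub_closed (colon1 A m).
Proof. by move=> hA r s Ar As; rewrite /colon1 /= scalerBl; exact: hA. Qed.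

Lemma colonR_sub_closed A (X : set M) : sub_closed A -> sub_closed (colonR A X).
Proof.
move=> hA r s Ar As _ [x Xx <-]; rewrite scalerBl.
by apply: hA; [apply: Ar | apply: As]; exists x.
Qed.

Lemma is_ideal0 I : is_ideal I -> I 0.
Proof. by case=> /set_mem. Qed.

Lemma is_idealD I x y : is_ideal I -> I x -> I y -> I (x + y).
Proof.
case=> _ hI Ix Iy; apply: set_mem; rewrite -[x]mul1r.
by apply: (hI 1 x y); apply: mem_set.
Qed.

Lemma is_idealMl I r x : is_ideal I -> I x -> I (r * x).
Proof.
move=> hI Ix; case: (hI) => _ h; apply: set_mem; rewrite -[_ * _]addr0.
by apply: (h r x 0); apply: mem_set => //; exact: is_ideal0.
Qed.

(** If [x * y = 1], every [z] is the multiple [z * y * x] of [x]. *)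
Lemma proper_ideal_nonunit I x : is_proper_ideal I -> I x -> nonunit x.
Proof.
move=> [hI IT] Ix [y xy]; apply: IT; apply/seteqP; split => // z _.
by rewrite -[z]mulr1 -xy mulrCA mulrC; exact: is_idealMl.
Qed.

Lemma principal_ideal (a : R) : is_ideal (mul_set a [set: R]).
Proof.
split; first by apply: mem_set; exists 0 => //; rewrite mulr0.
move=> r x y /set_mem[s _ <-] /set_mem[t _ <-]; apply: mem_set.
by exists (r * s + t) => //; rewrite mulrDr mulrCA.
Qed.

Lemma principal_self (a : R) : mul_set a [set: R] a.
Proof. by exists 1 => //; rewrite mulr1. Qed.

Lemma principal_proper (a : R) :
  nonunit a -> is_proper_ideal (mul_set a [set: R]).
Proof.
move=> na; split; first exact: principal_ideal.
move=> aT; apply: na; have : [set: R] 1 by [].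
by rewrite -aT => -[b _ ab]; exists b.
Qed.

Lemma set_scale_mul_setP A (a : R) I (m : M) :
  set_scale (mul_set a I) m `<=` A <-> forall i, I i -> A ((a * i) *: m).
Proof.
split=> [h i Ii|h _ [_ [i Ii <-] <-]]; last exact: h.
by apply: h; exists (a * i) => //; exists i.
Qed.

Lemma colonR_mul_setP A (a : R) I (m : M) (r : R) :
  colonR A (set_scale (mul_set a I) m) r <->
  forall i, I i -> A ((r * a * i) *: m).
Proof.
split=> [h i Ii|h _ [_ [_ [i Ii <-] <-] <-]].
  apply: h; exists ((a * i) *: m); last by rewrite scalerA mulrA.
  by exists (a * i) => //; exists i.
by rewrite scalerA mulrA; exact: h.
Qed.

Lemma ideal_mulM I J x y : I x -> J y -> ideal_mul I J (x * y).
Proof.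
move=> Ix Jy; exists 1, (fun=> x), (fun=> y); split => //.
by rewrite big_ord1.
Qed.

(** Elements of [ideal_mul I J] are finite sums of products. The empty sum is among them, so [A]
    must contain 0, which [sub_closed] would not give. *)
Lemma set_scale_ideal_mul A I J (m : M) : is_submodule A ->
  (forall x y, I x -> J y -> A ((x * y) *: m)) ->
  set_scale (ideal_mul I J) m `<=` A.
Proof.
move=> hA h _ [_ [n [x [y [Ix Jy ->]]]] <-]; rewrite scaler_suml.
apply: (big_ind A) => [|u v Au Av|k _]; first exact: is_submodule0.
  by rewrite -[u]scale1r; exact: is_submodule_lin.
exact: h.
Qed.

Lemma set_scale_ideal_mul3 A I J (K : set R) (m : M) : is_submodule A ->
  (forall x y z, I x -> J y -> K z -> A ((x * y * z) *: m)) ->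
  set_scale (ideal_mul (ideal_mul I J) K) m `<=` A.
Proof.
move=> hA h; apply: set_scale_ideal_mul => // r z IJr Kz.
rewrite -scalerA.
(* The third factor is absorbed into the vector. *)
apply: (@set_scale_ideal_mul A I J (z *: m)); [by [] | | by exists r].
by move=> x y Ix Jy; rewrite scalerA; exact: h.
Qed.

End Submodules.

(** * Equivalence of the eight conditions *)

Theorem theorem2 (R : comNzRingType) (M : lmodType R)
    (phi : submodule M -> submodule_or_empty M)
    (hphi : forall L : submodule M, phi L `<=` L)
    (N : submodule M) (hN : (N : set M) <> [set: M]) :
  [<->
   (* 1 *)
   phi_classical_1abs_prime phi N;
   (* 2 *)
   forall a b c : R, nonunit a -> nonunit b -> nonunit c ->
     colonM N (a * b * c) =
       colonM (phi N) (a * b * c) `|` colonM N (a * b) `|` colonM N c;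
   (* 3 *)
   forall (a b : R) (m : M), nonunit a -> nonunit b ->
     ~ (N : set M) ((a * b) *: m) ->
     colon1 N ((a * b) *: m) = colon1 (phi N) ((a * b) *: m) `|` colon1 N m;
   (* 4 *)
   forall (a b : R) (m : M), nonunit a -> nonunit b ->
     ~ (N : set M) ((a * b) *: m) ->
     colon1 N ((a * b) *: m) = colon1 (phi N) ((a * b) *: m) \/
     colon1 N ((a * b) *: m) = colon1 N m;
   (* 5 *)
   forall (a b : R) (I : set R) (m : M), nonunit a -> nonunit b ->
     is_ideal I ->
     set_scale (mul_set (a * b) I) m `<=` N ->
     ~ (set_scale (mul_set (a * b) I) m `<=` phi N) ->
     (N : set M) ((a * b) *: m) \/ set_scale I m `<=` N;
   (* 6 *)
   forall (a b : R) (m : M) (I : set R), nonunit a -> nonunit b ->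
     is_proper_ideal I ->
     set_scale (mul_set (a * b) I) m `<=` N ->
     ~ (set_scale (mul_set (a * b) I) m `<=` phi N) ->
     set_scale (mul_set a I) m `<=` N \/ (N : set M) (b *: m);
   (* 7 *)
   forall (I : set R) (a : R) (m : M), is_proper_ideal I -> nonunit a ->
     ~ (set_scale (mul_set a I) m `<=` N) ->
     colonR N (set_scale (mul_set a I) m) =
       colonR (phi N) (set_scale (mul_set a I) m) \/
     colonR N (set_scale (mul_set a I) m) = colon1 N m;
   (* 8 *)
   forall (I J K : set R) (m : M),
     is_proper_ideal I -> is_proper_ideal J -> is_proper_ideal K ->
     set_scale (ideal_mul (ideal_mul I J) K) m `<=` N ->
     ~ (set_scale (ideal_mul (ideal_mul I J) K) m `<=` phi N) ->
     set_scale (ideal_mul I J) m `<=` N \/ set_scale K m `<=` N].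
Proof.
have PN x : (phi N : set M) x -> (N : set M) x by exact: hphi.
have hNs := submoduleP N.
have NB := is_submoduleB hNs.
have NZ r x : (N : set M) x -> (N : set M) (r *: x) by exact: is_submoduleZ.
have PB := @submodule_or_emptyB _ _ (phi N).
(* Units cancel in memberships in [N]. This is how arbitrary elements of a colon are shown to be
   nonunits before a condition on nonunits is applied to them. *)
have unitN r x : ~ nonunit r -> (N : set M) (r *: x) -> (N : set M) x.
  move=> /contrapT[s rs] /(NZ s).
  by rewrite scalerA mulrC rs scale1r.
tfae.
- move=> [_ h1] a b c na nb nc; apply/seteqP; split=> m.
    move=> Nm; have [Pm|nPm] := pselect ((phi N : set M) ((a * b * c) *: m)).
      by left; left.
    by case: (h1 a b c m na nb nc (conj Nm nPm)) => ?; [left; right|right].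
  rewrite /colonM /=; case=> [[/PN //|h]|h].
    2: by rewrite -scalerA; exact: NZ.
  by rewrite [_ * c]mulrC -scalerA; exact: NZ.
- move=> h2 a b m na nb nabm; apply/seteqP; split=> r; rewrite /colon1 /=.
    (* A unit [r] would put [(a * b) *: m] in [N]. So (2) applies with [c = r], and its middle colon
       is excluded for the same reason. *)
    move=> Nr; have nr : nonunit r.
      by apply: contrapT => /unitN /(_ Nr).
    have : colonM N (a * b * r) m by rewrite /colonM /= mulrC -scalerA.
    rewrite (h2 a b r na nb nr) => -[[|/nabm[]]|]; last by right.
    by rewrite /colonM /= mulrC -(scalerA r) => Pr; left.
  by case=> [/PN //|/(NZ (a * b))]; rewrite !scalerA [r * _]mulrC.
- move=> h3 a b m na nb nabm; apply: sub_closedU (h3 a b m na nb nabm) => //;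
    exact: colon1_sub_closed.
- move=> h4 a b I m na nb hI /set_scale_mul_setP abN abP.
  have [|nabm] := pselect ((N : set M) ((a * b) *: m)); first by left.
  have IN i : I i -> colon1 N ((a * b) *: m) i.
    by move=> Ii; rewrite /colon1 /= scalerA mulrC; exact: abN.
  (* Whichever colon (4) selects contains [I]; the one for [phi N] contradicts [abP]. *)
  right; case: (h4 a b m na nb nabm) => cE; rewrite cE in IN.
    exfalso; apply: abP; apply/set_scale_mul_setP => i /IN.
    by rewrite /colon1 /= scalerA mulrC.
  by move=> _ [i /IN Ni <-].
- move=> h5 a b m I na nb hI /set_scale_mul_setP abN abP.
  have [|nbm] := pselect ((N : set M) (b *: m)); [by right|left].
  (* For an escaping [i], (5) is applied with [i] as second nonunit and the principal ideal of [b]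
     as ideal: [i] and [b] exchange roles. *)
  have key i : I i -> ~ (phi N : set M) ((a * b * i) *: m) ->
      (N : set M) ((a * i) *: m).
    move=> Ii nP; have ni := proper_ideal_nonunit hI Ii.
    case: (h5 a i (mul_set b [set: R]) m na ni (principal_ideal b)) => //.
    + apply/set_scale_mul_setP => _ [r _ <-].
      have -> : a * i * (b * r) = r * (a * b * i).
        by rewrite mulrACA mulrA mulrC.
      by rewrite -scalerA; apply/NZ/abN.
    + move/set_scale_mul_setP/(_ b (principal_self b)).
      by rewrite mulrAC.
    + move=> bN; exfalso; apply/nbm/bN.
      by exists b => //; exact: principal_self.
  have [i0 Ii0 nP0] : exists2 i, I i & ~ (phi N : set M) ((a * b * i) *: m).
    apply: contrapT => h; apply/abP/set_scale_mul_setP => i Ii.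
    by apply: contrapT => nP; apply: h; exists i.
  apply/set_scale_mul_setP => i Ii.
  have [Pi|] := pselect ((phi N : set M) ((a * b * i) *: m)); last exact: key.
  (* Here [i = (i + i0) - i0], and [i + i0] escapes because [i0 = (i + i0) - i]. *)
  rewrite -(addrK i0 i) mulrBr scalerBl; apply: NB; last exact: key.
  apply: key; first exact: is_idealD hI.1 Ii Ii0.
  move=> Pii0; apply: nP0; rewrite -(addKr i i0) addrC mulrBr scalerBl.
  exact: PB.
- move=> h6 I a m hI na nN; apply: sub_closedU; try exact: colonR_sub_closed.
    exact: colon1_sub_closed.
  apply/seteqP; split=> r.
    move=> /colonR_mul_setP rN.
    have nr : nonunit r.
      apply: contrapT => /unitN ur; apply/nN/set_scale_mul_setP => i Ii.
      by apply: ur; rewrite scalerA mulrA; exact: rN.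
    (* Outside [phi N], (6) is applied with [b = r]; its first outcome is excluded by [nN]. *)
    have [rP|nrP] := pselect (set_scale (mul_set (a * r) I) m `<=` phi N).
      left; apply/colonR_mul_setP; rewrite mulrC.
      exact/set_scale_mul_setP.
    case: (h6 a r m I na nr hI) => //; last by right.
    by apply/set_scale_mul_setP; rewrite mulrC.
  move=> h; apply/colonR_mul_setP => i Ii; case: h => [/colonR_mul_setP h|].
    exact/PN/h.
  by move=> /(NZ (a * i)); rewrite scalerA mulrC mulrA.
- move=> h7 I J K m hI hJ hK IJKN IJKP.
  have [|nKN] := pselect (set_scale K m `<=` N); [by right|left].
  apply: contrapT => nIJN; apply: IJKP.
  (* [K] lies in the colon of [N] by [a J m], and (7) identifies this colon. It cannot be
     [colon1 N m], as [K m] is not inside [N]; hence [a J K m] lies in [phi N]. *)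
  have key a : I a -> ~ (set_scale (mul_set a J) m `<=` N) ->
      forall j k, J j -> K k -> (phi N : set M) ((a * j * k) *: m).
    move=> Ia naJ.
    have KN k : K k -> colonR N (set_scale (mul_set a J) m) k.
      move=> Kk; apply/colonR_mul_setP => j Jj; rewrite -mulrA mulrC.
      by apply: IJKN; exists (a * j * k) => //; do 2?apply: ideal_mulM.
    case: (h7 J a m hJ (proper_ideal_nonunit hI Ia) naJ) => cE;
        rewrite cE in KN.
      move=> j k Jj /KN/colonR_mul_setP/(_ j Jj).
      by rewrite -mulrA mulrC.
    by exfalso; apply: nKN => _ [k /KN Nk <-].
  have [a0 Ia0 na0] : exists2 a, I a & ~ (set_scale (mul_set a J) m `<=` N).
    apply: contrapT => h; apply: nIJN.
    apply: (set_scale_ideal_mul hNs) => a j Ia Jj.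
    apply: contrapT => nN; apply: h; exists a => //.
    by move/set_scale_mul_setP/(_ j Jj).
  (* The zeros of [J] and [K] provide an element of [phi N], which is therefore not empty. *)
  have hPs : is_submodule (phi N).
    apply: (@submodule_or_empty_submodule _ _ _ ((a0 * 0 * 0) *: m)).
    exact: key Ia0 na0 _ _ (is_ideal0 (proj1 hJ)) (is_ideal0 (proj1 hK)).
  apply: set_scale_ideal_mul3 => // a j k Ia Jj Kk.
  have [aN|naN] := pselect (set_scale (mul_set a J) m `<=` N); last exact: key.
  (* If [a J m] stays in [N], then [a + a0] still moves [J m] out of [N], so [key] covers both terms
     of [(a + a0) - a0]. *)
  rewrite -(addrK a0 a) !mulrBl scalerBl; apply: PB; last exact: key.
  apply: key => //; first exact: (is_idealD hI.1).
  move/set_scale_mul_setP => saN; apply/na0/set_scale_mul_setP => i Ji.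
  rewrite -(addKr a a0) addrC mulrBl scalerBl; apply: NB; first exact: saN.
  by move/set_scale_mul_setP: aN; apply.
- move=> h8; split=> // a b c m na nb nc [Nabc nP].
  case: (h8 _ _ _ m (principal_proper na) (principal_proper nb)
            (principal_proper nc)).
  + apply: set_scale_ideal_mul3 => // _ _ _ [x _ <-] [y _ <-] [z _ <-].
    have -> : a * x * (b * y) * (c * z) = x * y * z * (a * b * c).
      by rewrite (mulrACA a) (mulrACA (a * b)) mulrC.
    by rewrite -scalerA; exact: NZ.
  (* The product of the three generators witnesses the escape from [phi N]; the two outcomes of (8)
     are likewise evaluated at generators. *)
  + move=> hP; apply/nP/hP; exists (a * b * c) => //.
    by do 2?apply: ideal_mulM; exact: principal_self.
  + move=> h; left; apply: h; exists (a * b) => //.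
    by apply: ideal_mulM; exact: principal_self.
  + by move=> h; right; apply: h; exists c => //; exact: principal_self.
Qed.
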